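(* Let $G$ be a graph, $\theta$ a real number, and $X\subseteq V(G)$ with $|X|>1$. Then $X$ is a $\theta$-extreme set in $G$ if and only if $X$ is $\theta$-nice in $G$, i.e. if and only if $\mathrm{mult}(\theta,G\setminus \{u,v\})=\mathrm{mult}(\theta,G)+2$ for all distinct $u,v\in X$.
   Context: All graphs are finite and simple. For a graph $G$ on $n$ vertices, let $p(G,r)$ be the number of $r$-matchings of $G$ ($p(G,0)=1$); the matching polynomial is $\mu(G,x)=\sum_{r=0}^{\lfloor n/2\rfloor}(-1)^r p(G,r)x^{n-2r}$. For real $\theta$, $\mathrm{mult}(\theta,G)$ is the multiplicity of $\theta$ as a root of $\mu(G,x)$ (it is $0$ if $\theta$ is not a root). For $X\subseteq V(G)$, $G\setminus X$ is the graph obtained by deleting the vertices of $X$ and their incident edges. A set $X\subseteq V(G)$ is a $\theta$-extreme set if $\mathrm{mult}(\theta,G\setminus X)=\mathrm{mult}(\theta,G)+|X|$. A set $X$ with $|X|>1$ is $\theta$-nice if $\mathrm{mult}(\theta,G\setminus\{u,v\})=\mathrm{mult}(\theta,G)+2$ for all distinct $u,v\in X$. *)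

(* Defs.v *)
From HB Require Import structures.
From mathcomp Require Import all_boot all_order all_algebra.
Set Implicit Arguments. Unset Strict Implicit. Unset Printing Implicit Defensive.
Import Order.TTheory GRing.Theory Num.Theory.

(* A finite simple graph: vertex type T : finType, adjacency e : rel T
   (assumed symmetric and irreflexive in the theorem).
   Graphs of the form G \ X are represented by their vertex set
   S = V(G) \ X (induced subgraph on S). *)

Local Open Scope ring_scope.

Section Matching.
Variables (T : finType) (e : rel T).

Definition is_edge (f : {set T}) : bool :=
  [exists u, exists v, [&& u != v, e u v & f == [set u; v]]].

Definition is_matching_in (S : {set T}) (M : {set {set T}}) : bool :=
  [forall f in M, is_edge f && (f \subset S)] &&
  [forall f in M, forall g in M, (f != g) ==> [disjoint f & g]].

Definition nmatch (S : {set T}) (r : nat) : nat :=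
  #|[set M : {set {set T}} | is_matching_in S M & #|M| == r]|.

Definition match_poly (R : nzRingType) (S : {set T}) : {poly R} :=
  \sum_(r < (#|S| %/ 2)%N.+1)
     ((-1) ^+ r * (nmatch S r)%:R) *: 'X^(#|S| - 2 * r)%N.

Definition del (X : {set T}) : {set T} := ~: X.

Definition mult (R : fieldType) (theta : R) (X : {set T}) : nat :=
  mup theta (match_poly R (del X)).

Definition extreme (R : fieldType) (theta : R) (X : {set T}) : Prop :=
  mult theta X = (mult theta set0 + #|X|)%N.

Definition nice (R : fieldType) (theta : R) (X : {set T}) : Prop :=
  (1 < #|X|)%N /\
  forall u v, u \in X -> v \in X -> u != v ->
    mult theta [set u; v] = (mult theta set0 + 2)%N.

End Matching.

(* Main.v *)
Require Import Defs.
From HB Require Import structures.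
From mathcomp Require Import all_boot all_order all_algebra.
From mathcomp Require Import polyrcf ring lra zify.

(** Write F(S) for the matching polynomial of the subgraph induced on S and
    ord(S) for the multiplicity of theta in it.  The vertex recurrence
    F(S) = x_u F(S\u) - sum_(v ~ u) F(S\u\v), even with arbitrary vertex weights
    x_u, yields the Rayleigh inequality F(S\u) F(S\v) - F(S) F(S\u\v) >= 0 at all
    real points.

    - Summing it over v, and using F(S)' = sum_v F(S\v), bounds the Wronskian of
      F(S) and F(S\u) below by F(S\u)^2.  Hence ord(S) <= ord(S\u) + 1, and the
      recurrence then gives ord(S\u) <= ord(S) + 1.  So an extreme set contains
      only extreme pairs.
    - Adding c to the weight of a third vertex w turns the Rayleigh inequality into
      a quadratic A + B c + C c^2 >= 0, so B^2 <= 4 A C.  If the three pairs in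
      {u,v,w} are extreme, comparing orders at theta forces {u,v,w} to be extreme,
      since B contains the term F(S) F(S\u\v\w).  Thus deleting a vertex w of a
      nice set X leaves X\w nice in the graph without w, and induction concludes. *)

Set Implicit Arguments. Unset Strict Implicit. Unset Printing Implicit Defensive.
Import Order.TTheory GRing.Theory Num.Theory.
Local Open Scope ring_scope.

Lemma setD1C (T : finType) (A : {set T}) a b : A :\ a :\ b = A :\ b :\ a.
Proof. by rewrite setDDl setUC -setDDl. Qed.

(** * Matchings and the vertex recurrence *)

Section Recurrence.
Variables (T : finType) (e : rel T).
Hypotheses (e_sym : symmetric e) (e_irr : irreflexive e).
Implicit Types (S f : {set T}) (M N : {set {set T}}) (u v w : T).

Lemma is_edge_pair u v : e u v -> is_edge e [set u; v].
Proof.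
move=> uv; apply/existsP; exists u; apply/existsP; exists v.
by rewrite uv eqxx !andbT; apply: contraTneq uv => ->; rewrite e_irr.
Qed.

Lemma is_edge_inE u f :
  is_edge e f -> u \in f -> exists2 v, e u v & f = [set u; v].
Proof.
case/existsP=> a /existsP [b /and3P [_ ab /eqP ->]].
by rewrite !inE => /orP [] /eqP ->; [exists b | exists a; rewrite 1?e_sym 1?setUC].
Qed.

Lemma card_edge f : is_edge e f -> #|f| = 2%N.
Proof. by case/existsP=> a /existsP [b /and3P [ab _ /eqP ->]]; rewrite cards2 ab. Qed.

Lemma matchingP S M :
  reflect ((forall f, f \in M -> is_edge e f /\ f \subset S) /\ trivIset M)
          (is_matching_in e S M).
Proof.
apply: (iffP andP) => [[/forallP h1 /forallP h2] | [h1 /trivIsetP h2]].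
  split=> [f fM | ]; first by apply/andP/(implyP (h1 f)).
  apply/trivIsetP=> f g fM gM.
  by apply/implyP; move/forallP: (implyP (h2 f) fM) => /(_ g) /implyP; apply.
split; first by apply/forallP=> f; apply/implyP=> /h1 /andP.
apply/forallP=> f; apply/implyP=> fM; apply/forallP=> g; apply/implyP=> gM.
by apply/implyP; apply: h2.
Qed.

Lemma card_matching S M : is_matching_in e S M -> (2 * #|M| <= #|S|)%N.
Proof.
case/matchingP=> h /eqP tr.
have -> : (2 * #|M| = \sum_(f in M) #|f|)%N.
  rewrite mulnC -sum_nat_const; apply: eq_bigr => f /h [ed _].
  by rewrite card_edge.
by rewrite tr; apply/subset_leq_card/bigcupsP => f /h [].
Qed.

(** Summing over matchings instead of over sizes lets the recurrence be proved by bijections on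
    index sets. *)
Lemma match_polyE (R : nzRingType) S :
  match_poly e R S =
  \sum_(M | is_matching_in e S M) (-1) ^+ #|M| *: 'X^(#|S| - 2 * #|M|).
Proof.
rewrite /match_poly (partition_big (fun M => inord #|M| : 'I_(#|S| %/ 2).+1) xpredT) //=.
apply: eq_bigr => r _.
(* [inord] does not truncate here: a matching in S has at most #|S| / 2 edges. *)
have inE' M : is_matching_in e S M -> (inord #|M| == r) = (#|M| == r).
  move=> /card_matching h; rewrite -val_eqE /= inordK // ltnS leq_divRL // mulnC; exact: h.
rewrite (eq_bigr (fun M => (-1) ^+ r *: 'X^(#|S| - 2 * r) : {poly R})); last first.
  by move=> M /andP [Mm]; rewrite inE' // => /eqP ->.
rewrite (eq_bigl (fun M => M \in [set M | is_matching_in e S M & #|M| == r])); last first.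
  by move=> M; rewrite [RHS]inE; apply: andb_id2l => /inE'.
by rewrite sumr_const -/(nmatch e S r) -scaler_nat scalerA commr_nat.
Qed.

Lemma match_poly_set0 (R : nzRingType) : match_poly e R set0 = 1.
Proof.
rewrite match_polyE (big_pred1 set0) ?cards0 ?expr0 ?scale1r // => M.
apply/idP/eqP => [/card_matching | ->].
  by rewrite cards0 => h; apply/eqP; rewrite -cards_eq0; lia.
by apply/matchingP; split=> [f|]; rewrite ?inE //; apply/trivIsetP=> f g; rewrite inE.
Qed.

Lemma matching_setD1 S M u :
  is_matching_in e (S :\ u) M = is_matching_in e S M && (u \notin cover M).
Proof.
apply/matchingP/andP => [[h tr] | [/matchingP [h tr] uM]].
  split; first by apply/matchingP; split=> // f /h [? /subsetD1P []].
  by apply/bigcupP=> -[f /h [_ /subsetD1P [_ /negP]]].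
split=> // f fM; case: (h f fM) => ? ?; split=> //; apply/subsetD1P; split=> //.
by apply: contra uM => uf; apply/bigcupP; exists f.
Qed.

Lemma matching_setU1 S N u v : u \in S -> v \in S -> e u v ->
  is_matching_in e S ([set u; v] |: N) && ([set u; v] \notin N) =
  is_matching_in e (S :\ u :\ v) N.
Proof.
move=> uS vS uv; set f := [set u; v].
have -> : S :\ u :\ v = S :\: f by rewrite -setDDl.
apply/andP/matchingP => [[/matchingP [h /trivIsetP tr] fN] | [h /trivIsetP tr]].
  split=> [g gN|]; last by apply/trivIsetP=> a b aN bN; apply: tr; apply/setU1P; right.
  have [|ge gS] := h g; first by apply/setU1P; right.
  split=> //; rewrite subsetD gS /= tr //; first by apply/setU1P; right.
    by apply/setU1P; left.
  by apply: contraNneq fN => <-.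
have dj g : g \in N -> [disjoint g & f] by move=> /h [_]; rewrite subsetD => /andP [].
split.
  apply/matchingP; split=> [g /setU1P [->|/h [? /subset_trans]] | ].
  - by split; [exact: is_edge_pair | rewrite subUset !sub1set uS].
  - by move=> sub; split=> //; apply: sub; apply: subsetDl.
  apply/trivIsetP=> a b /setU1P [->|aN] /setU1P [->|bN]; rewrite ?eqxx //.
  - by move=> _; rewrite disjoint_sym dj.
  - by move=> _; rewrite dj.
  - exact: tr.
by apply/negP=> /dj; rewrite -setI_eq0 setIid => /eqP f0; have := set21 u v; rewrite -/f f0 inE.
Qed.

(** Matchings that miss u are the matchings of S \ u; those that cover u are sorted by the other
    endpoint v of the edge at u, and removing that edge leaves a matching of S \ u \ v. *)
Lemma match_poly_rec (R : comNzRingType) S u : u \in S ->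
  match_poly e R S = 'X * match_poly e R (S :\ u)
    - \sum_(v in S | e u v) match_poly e R (S :\ u :\ v).
Proof.
move=> uS; rewrite {1}match_polyE (bigID (fun M => u \in cover M)) /= addrC.
have cS : #|S| = #|S :\ u|.+1 by rewrite (cardsD1 u) uS.
congr (_ + _).
  rewrite match_polyE mulr_sumr; apply: eq_big => M; first by rewrite matching_setD1.
  rewrite -matching_setD1 => /card_matching h.
  by rewrite -scalerAr -exprS cS subSn.
rewrite -sumrN.
(* By disjointness of its edges, a matching that covers u occurs for exactly one v. *)
transitivity (\sum_(v in S | e u v) \sum_(M | is_matching_in e S M && ([set u; v] \in M))
   (-1) ^+ #|M| *: 'X^(#|S| - 2 * #|M|) : {poly R}).
  rewrite (exchange_big_dep (is_matching_in e S)) /=; last by move=> ? ? _ /andP [].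
  rewrite [RHS](bigID (fun M => u \in cover M)) /= [X in _ = _ + X]big1 ?addr0; last first.
    move=> M /andP [Mm uM]; apply: big1 => v /andP [_ /andP [_ fM]].
    by case/bigcupP: uM; exists [set u; v]; rewrite ?set21.
  apply: eq_bigr => M /andP [/[dup] Mm /matchingP [h tr] /bigcupP [f fM uf]].
  have [fe fS] := h _ fM.
  have [v uv fE] := is_edge_inE fe uf.
  have vS : v \in S by apply: (subsetP fS); rewrite fE set22.
  rewrite (big_pred1 v) // => w; rewrite Mm /=; apply/idP/eqP => [|->].
    case/andP=> /andP [_ uw] wM.
    have E : [set u; w] = f.
      apply/eqP; apply: contraTT isT => /(trivIsetP tr _ _ wM fM).
      by rewrite -setI_eq0 => /eqP/setP/(_ u); rewrite !inE eqxx uf.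
    have : w \in f by rewrite -E set22.
    by rewrite fE !inE => /orP [] /eqP // wu; rewrite wu e_irr in uw.
  by rewrite vS uv -fE.
apply: eq_bigr => v /andP [vS uv]; rewrite match_polyE -sumrN; set f := [set u; v].
rewrite (reindex_onto (fun N => f |: N) (fun M => M :\ f)) /=; last first.
  by move=> M /andP [_ fM]; rewrite setD1K.
apply: eq_big => N.
  rewrite setU11 andbT -(matching_setU1 N uS vS uv) -/f; congr andb.
  apply/eqP/idP => [<-|fN]; first by rewrite setD11.
  by rewrite setU1K.
case/andP=> /andP [Mm _] /eqP fN.
have fN' : f \notin N by rewrite -fN setD11.
have vu : v \in S :\ u by rewrite !inE vS andbT; apply: contraTneq uv => ->; rewrite e_irr.
rewrite cardsU1 fN' cS (cardsD1 v (S :\ u)) vu.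
by rewrite exprS mulN1r scaleNr mulnDr -addSn subnDl.
Qed.

End Recurrence.

(** * Inequalities between real polynomials and order of vanishing *)

Section Order.
Variable R : rcfType.
Implicit Types (p q : {poly R}) (t : R).

Lemma horner_ge0_lim t p :
  (forall x, x != t -> 0 <= p.[x]) -> 0 <= p.[t].
Proof.
move=> h; rewrite leNgt; apply/negP => pt.
(* If p(t) < 0, continuity with tolerance -p(t) keeps p negative at t + d/2, a point different from
   t. *)
have [|d d0 /(_ (t + d / 2))] := @poly_cont R t p (- p.[t]); first by lra.
rewrite addrAC subrr add0r gtr0_norm; last by lra.
have := h (t + d / 2); rewrite ltr_norml.
have -> : t + d / 2 != t by apply/eqP => E; lra.
move=> /(_ isT) h1 h2; have : d / 2 < d by lra.
by move=> /h2 /andP [_]; lra.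
Qed.

(** Induction on k: q(t) = 0 forces p(t) = 0, so p loses one factor X - t and q loses two. The
    inequality between the quotients holds off t, and at t by continuity. *)
Lemma dvdp_sqr_le t p q k :
  (forall x, p.[x] ^+ 2 <= q.[x]) ->
  ('X - t%:P) ^+ (2 * k).+1 %| q -> ('X - t%:P) ^+ k.+1 %| p.
Proof.
elim: k p q => [|k IH] p q le_pq.
  rewrite muln0 !expr1 !dvdp_XsubCl => /rootP qt; apply/rootP/eqP.
  by rewrite -sqrf_eq0 eq_le sqr_ge0 andbT -qt.
rewrite (_ : (2 * k.+1).+1 = (2 + (2 * k).+1)%N); last by lia.
rewrite exprD => dq.
have qt : q.[t] = 0.
  by apply/rootP; rewrite -dvdp_XsubCl; apply: dvdp_trans dq; rewrite expr2 -!mulrA dvdp_mulr.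
have : 'X - t%:P %| p.
  by rewrite dvdp_XsubCl; apply/rootP/eqP; rewrite -sqrf_eq0 eq_le sqr_ge0 andbT -qt.
case/dvdpP => p1 Ep; case/dvdpP: (dvdp_trans (dvdp_mulr _ (dvdpp _)) dq) => q1 Eq.
move: dq; rewrite Eq mulrC dvdp_mul2r ?expf_neq0 ?polyXsubC_eq0 // => dq1.
rewrite Ep exprSr dvdp_mul2r ?polyXsubC_eq0 //; apply: IH dq1 => x.
have : 0 <= (q1 - p1 ^+ 2).[x]; last by rewrite !hornerE; lra.
have off y : y != t -> 0 <= (q1 - p1 ^+ 2).[y].
  move=> yt; have := le_pq y; rewrite Ep Eq !hornerE -[leRHS]mulrA -expr2 exprMn.
  have pos : 0 < (y - t) ^+ 2 by rewrite exprn_even_gt0 // subr_eq0.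
  by rewrite ler_pM2r // subr_ge0.
by have [->|/off //] := eqVneq x t; apply: horner_ge0_lim.
Qed.

Lemma quadratic_ge0_discr (a b c : R) :
  (forall x, 0 <= a * x ^+ 2 + b * x + c) -> b ^+ 2 <= 4 * a * c.
Proof.
move=> h; pose p := Poly [:: c; b; a].
have := @deg_le2_poly_ge0 R p (size_Poly _); rewrite !coef_Poly /= subr_le0; apply.
move=> x; have := h x; rewrite horner_Poly /=; congr (0 <= _); ring.
Qed.

End Order.

(** * The Rayleigh inequality and weight shifts *)

Section Rayleigh.
Variables (R : realDomainType) (T : finType) (e : rel T).
Hypothesis e_irr : irreflexive e.

(** Expanding F S and F (S \ v) along u cancels the weight of u. What remains is F (S \ u \ v)^2 if
    u ~ v, plus the same Rayleigh difference in S \ u for each pair w, v with w ~ u, w != v;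
    induction on #|S| applies to these. *)
Lemma rayleigh_ge0 (wt : T -> R) (F : {set T} -> R) :
  (forall (S : {set T}) u, u \in S ->
     F S = wt u * F (S :\ u) - \sum_(v in S | e u v) F (S :\ u :\ v)) ->
  forall (S : {set T}) u v, u \in S -> v \in S -> u != v ->
    0 <= F (S :\ u) * F (S :\ v) - F S * F (S :\ u :\ v).
Proof.
move=> recF S; have [n] := ubnP #|S|; elim: n S => // n IH S ltSn u v uS vS uv.
have vSu : v \in S :\ u by rewrite !inE eq_sym uv.
have uSv : u \in S :\ v by rewrite !inE uv.
rewrite (recF S u uS) (recF (S :\ v) u uSv) (setD1C S v u).
have -> : \sum_(w in S | e u w) F (S :\ u :\ w) =
  (if e u v then F (S :\ u :\ v) else 0) + \sum_(w in S :\ v | e u w) F (S :\ u :\ w).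
  rewrite (bigID (pred1 v)) /=; congr (_ + _); last first.
    by apply: eq_bigl => w; rewrite !inE andbAC [(w != v) && _]andbC.
  rewrite (eq_bigl (fun w => (w == v) && e u v)).
    by case: (e u v); [rewrite (big_pred1 v) | rewrite big_pred0] => // w;
      rewrite ?andbT ?andbF.
  by move=> w; case: eqVneq => [->|]; rewrite ?andbF ?andbT ?vS.
have E : F (S :\ u) * (wt u * F (S :\ u :\ v) - \sum_(w in S :\ v | e u w) F (S :\ v :\ u :\ w))
  - (wt u * F (S :\ u) - ((if e u v then F (S :\ u :\ v) else 0)
     + \sum_(w in S :\ v | e u w) F (S :\ u :\ w))) * F (S :\ u :\ v)
  = (if e u v then F (S :\ u :\ v) else 0) * F (S :\ u :\ v)
  + \sum_(w in S :\ v | e u w)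
      (F (S :\ u :\ w) * F (S :\ u :\ v) - F (S :\ u) * F (S :\ u :\ w :\ v)).
  rewrite sumrB -mulr_suml -mulr_sumr.
  under [X in _ = _ + (_ - _ * X)]eq_bigr => w _ do rewrite -(setD1C (S :\ u) v w) -(setD1C S v u).
  by ring.
rewrite -(setD1C S v u) in E *; rewrite {}E (setD1C S v u); apply: addr_ge0.
  by case: (e u v); rewrite ?mul0r // -expr2 sqr_ge0.
apply: sumr_ge0 => w /andP [wSv uw]; move: wSv; rewrite !inE => /andP [wv wS].
apply: IH => //.
  by move: ltSn; rewrite (cardsD1 u) uS.
by rewrite !inE wS andbT; apply: contraTneq uw => ->; rewrite e_irr.
Qed.

End Rayleigh.

(** F is affine in the weight of w with slope F (S \ w), which explains the formula for [F']. *)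
Lemma shift_weight_rec (R : comNzRingType) (T : finType) (e : rel T)
    (wt : T -> R) (F : {set T} -> R) (w : T) (c : R) :
  (forall (S : {set T}) u, u \in S ->
     F S = wt u * F (S :\ u) - \sum_(v in S | e u v) F (S :\ u :\ v)) ->
  let wt' u := wt u + (if u == w then c else 0) in
  let F' S := F S + (if w \in S then c * F (S :\ w) else 0) in
  forall (S : {set T}) u, u \in S ->
     F' S = wt' u * F' (S :\ u) - \sum_(v in S | e u v) F' (S :\ u :\ v).
Proof.
move=> recF wt' F' S u uS; rewrite /F' /wt'.
have [uw|uw] := eqVneq u w.
  rewrite -uw uS setD11 (recF S u uS).
  rewrite [X in _ = _ - X](eq_bigr (fun v => F (S :\ u :\ v))); last first.
    by move=> v _; rewrite !inE eqxx andbF addr0.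
  ring.
have wE (A : {set T}) : (w \in A :\ u) = (w \in A) by rewrite !inE eq_sym uw.
rewrite wE (recF S u uS) !addr0 big_split /= mulrDr opprD addrACA; congr (_ + _).
have [wS|wS] := boolP (w \in S); last first.
  rewrite mulr0 big1 ?subr0 // => v _.
  by rewrite ifN // inE wE (negbTE wS) andbF.
have uSw : u \in S :\ w by rewrite !inE uw.
rewrite (recF _ _ uSw) mulrBr (setD1C S w u) mulrCA; congr (_ - _).
rewrite mulr_sumr [RHS](bigID (pred1 w)) /= [X in _ = X + _]big1 ?add0r; last first.
  by move=> v /andP [_ /eqP ->]; rewrite setD11.
apply: eq_big => v; first by rewrite !inE [RHS]andbAC [(v != w) && _]andbC.
rewrite in_setD1 => /andP [/andP [vw vS] _].
by rewrite in_setD1 wE wS eq_sym vw setD1C.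
Qed.

(** * Derivatives and the Wronskian of matching polynomials *)

Section Multiplicity.
Variables (R : rcfType) (T : finType) (e : rel T).
Hypotheses (e_sym : symmetric e) (e_irr : irreflexive e).
Variable t : R.
Implicit Types (S X : {set T}) (u v w : T).
Local Notation P := (match_poly e R).
Local Notation d k p := (('X - t%:P) ^+ k %| p).

Lemma match_poly_neq0 S : P S != 0.
Proof.
suff : (P S)`_#|S| = 1.
  by move=> h; apply: contra_eq_neq h => ->; rewrite coef0 eq_sym oner_neq0.
have m0 : is_matching_in e S set0.
  by apply/matchingP; split=> [f|]; rewrite ?inE //; apply/trivIsetP=> f g; rewrite inE.
rewrite match_polyE // (bigD1 set0) //= coefD coef_sum big1 ?addr0.
  by rewrite cards0 subn0 expr0 scale1r coefXn eqxx.
move=> M /andP [/card_matching cM M0]; rewrite coefZ coefXn.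
have M_gt0 : (0 < #|M|)%N by rewrite card_gt0.
rewrite (_ : (_ == _) = false) ?mulr0 //; apply/negbTE/eqP.
have := cM; move: M_gt0; set k := #|M|; set n := #|S|; lia.
Qed.

Lemma deriv_match_poly S : (P S)^`() = \sum_(v in S) P (S :\ v).
Proof.
have [n] := ubnP #|S|; elim: n S => // n IH S ltSn.
have [->|[u uS]] := set_0Vmem S; first by rewrite match_poly_set0 // derivC big_set0.
have lt1 : (#|S :\ u| < n)%N by move: ltSn; rewrite (cardsD1 u) uS.
rewrite (match_poly_rec e_sym e_irr _ uS) derivB derivM derivX mul1r IH //.
rewrite (big_setD1 u uS) /= -addrA; congr (_ + _).
(* Each S \ w is expanded along u as well; exchanging the double sum then produces the derivatives
   of P (S \ u \ v). *)
rewrite [RHS](eq_bigr (fun w => 'X * P (S :\ u :\ w)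
   - \sum_(v in S :\ w | e u v) P (S :\ w :\ u :\ v))); last first.
  move=> w; rewrite !inE => /andP [wu wS].
  have uSw : u \in S :\ w by rewrite !inE eq_sym wu.
  by rewrite (match_poly_rec e_sym e_irr R uSw) (setD1C S w u).
rewrite sumrB -mulr_sumr; congr (_ - _).
rewrite raddf_sum [RHS](exchange_big_dep (fun v => (v \in S) && e u v)) /=; last first.
  by move=> w v _; rewrite !inE => /andP [/andP [_ ->] ->].
apply: eq_bigr => v /andP [vS uv].
rewrite IH; last by apply: leq_ltn_trans lt1; rewrite subset_leq_card // subsetDl.
apply: eq_big => w; last by move=> _; rewrite (setD1C (S :\ u) v w) (setD1C S u w).
by rewrite !inE vS uv !andbT andbC [v == w]eq_sym.
Qed.

Lemma horner_match_poly_rec x S u : u \in S ->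
  (P S).[x] = x * (P (S :\ u)).[x] - \sum_(v in S | e u v) (P (S :\ u :\ v)).[x].
Proof.
move=> uS; rewrite (match_poly_rec e_sym e_irr R uS) hornerD hornerN hornerM hornerX.
by congr (_ - _); apply: horner_sum.
Qed.

Lemma rayleigh_match_poly S u v x : u \in S -> v \in S -> u != v ->
  0 <= (P (S :\ u)).[x] * (P (S :\ v)).[x] - (P S).[x] * (P (S :\ u :\ v)).[x].
Proof.
move=> uS vS uv.
apply: (@rayleigh_ge0 R T e e_irr (fun=> x) (fun S => (P S).[x])) => //.
exact: horner_match_poly_rec.
Qed.

(** The derivative formula turns the Wronskian into a sum over v in S: v = u gives the square, every
    other v a Rayleigh difference. *)
Lemma wronskian_match_poly S u x : u \in S ->
  (P (S :\ u)).[x] ^+ 2 <= (P (S :\ u) * (P S)^`() - P S * (P (S :\ u))^`()).[x].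
Proof.
move=> uS; rewrite !deriv_match_poly (big_setD1 u uS) /= hornerD hornerN !hornerM hornerD.
rewrite ![(\sum_(_ in _) _).[x]]horner_sum -subr_ge0.
have cancel (a b c f : R) : a * (a + b) - c * f - a ^+ 2 = a * b - c * f by ring.
rewrite cancel !mulr_sumr -sumrB; apply: sumr_ge0 => v.
rewrite !inE => /andP [vu vS].
by apply: rayleigh_match_poly => //; rewrite eq_sym.
Qed.

Lemma dvdp_XsubC_le k l p : (k <= l)%N -> d l p -> d k p.
Proof. by move=> kl; apply: dvdp_trans; apply: dvdp_exp2l. Qed.

Lemma dvdp_XsubC_mul n k l p q : (n <= k + l)%N -> d k p -> d l q -> d n (p * q).
Proof. by move=> nkl dp dq; apply: dvdp_XsubC_le nkl _; rewrite exprD dvdp_mul. Qed.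

Lemma dvdp_XsubC_deriv k p : d k p -> d k.-1 p^`().
Proof.
case: k => [|k] /=; first by rewrite expr0 !dvd1p.
case/dvdpP=> q ->; rewrite derivM deriv_exp derivXsubC mul1r /=.
apply: dvdp_add; first by rewrite exprS !dvdp_mull.
by rewrite -mulr_natr mulrA dvdp_mulr // dvdp_mull.
Qed.

(** * Deleting one vertex changes the order by at most one *)

Local Notation ord S := (mup t (P S)).

Lemma ord_geq S k : (k <= ord S)%N = d k (P S).
Proof. by rewrite mup_geq ?match_poly_neq0. Qed.

Lemma ord_dvd S : d (ord S) (P S).
Proof. by rewrite -ord_geq. Qed.

Lemma ord_leS_del S u : u \in S -> (ord S <= (ord (S :\ u)).+1)%N.
Proof.
move=> uS; rewrite leqNgt; apply/negP => lt.
have := leqnn (ord (S :\ u)); rewrite leqNgt => /negP; apply.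
(* With b the order at S \ u and order at least b + 2 at S, the Wronskian vanishes to order 2b + 1,
   which would push the order at S \ u beyond b. *)
rewrite ord_geq; apply: dvdp_sqr_le (fun x => wronskian_match_poly x uS) _.
have dS := ord_dvd S; have dSu := ord_dvd (S :\ u).
apply: dvdp_sub.
  by apply: dvdp_XsubC_mul dSu (dvdp_XsubC_deriv dS); lia.
by apply: dvdp_XsubC_mul dS (dvdp_XsubC_deriv dSu); lia.
Qed.

Lemma ord_del_leS S u : u \in S -> (ord (S :\ u) <= (ord S).+1)%N.
Proof.
move=> uS; have [-> //|b_gt0] := posnP (ord (S :\ u)).
rewrite -(prednK b_gt0) ltnS ord_geq (match_poly_rec e_sym e_irr R uS).
apply: dvdp_sub; first by apply/dvdp_mull/(dvdp_XsubC_le _ (ord_dvd _))/leq_pred.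
elim/big_ind: _ => [|p q|]; [exact: dvdp0 | exact: dvdp_add | ].
move=> v /andP [vS uv]; rewrite -ord_geq -ltnS prednK // ord_leS_del //.
by rewrite !inE vS andbT; apply: contraTneq uv => ->; rewrite e_irr.
Qed.

(** * From extreme pairs to extreme triples *)

Lemma rayleigh_discr S u v w x : u \in S -> v \in S -> w \in S ->
  u != v -> u != w -> v != w ->
  (P (S :\ u) * P (S :\ v :\ w) + P (S :\ u :\ w) * P (S :\ v)
    - P (S :\ w) * P (S :\ u :\ v) - P S * P (S :\ u :\ v :\ w)).[x] ^+ 2 <=
  (4 *: ((P (S :\ u :\ w) * P (S :\ v :\ w) - P (S :\ w) * P (S :\ u :\ v :\ w))
    * (P (S :\ u) * P (S :\ v) - P S * P (S :\ u :\ v)))).[x].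
Proof.
move=> uS vS wS uv uw vw.
rewrite hornerZ hornerM mulrA; apply: quadratic_ge0_discr => c.
have := @rayleigh_ge0 R T e e_irr _ _
  (@shift_weight_rec R T e (fun=> x) (fun S => (P S).[x]) w c (@horner_match_poly_rec x)) S u v uS vS uv.
rewrite !inE wS -(eq_sym u) uw -(eq_sym v) vw /=.
by congr (0 <= _); rewrite !(hornerD, hornerN, hornerM); ring.
Qed.

(** The lower bound is bootstrapped: one-vertex deletion gives m + 1 for the triple, and the
    discriminant inequality raises it by one, twice. The upper bound is one-vertex deletion
    again. *)
Lemma ord_triple S u v w : u \in S -> v \in S -> w \in S ->
  u != v -> u != w -> v != w ->
  ord (S :\ u :\ v) = (ord S + 2)%N -> ord (S :\ u :\ w) = (ord S + 2)%N ->
  ord (S :\ v :\ w) = (ord S + 2)%N ->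
  ord (S :\ u :\ v :\ w) = (ord S + 3)%N.
Proof.
move=> uS vS wS uv uw vw Euv Euw Evw; set m := ord S in Euv Euw Evw *.
have inSu : v \in S :\ u by rewrite !inE eq_sym uv.
have inSv : w \in S :\ v by rewrite !inE eq_sym vw.
have inSuv : w \in S :\ u :\ v by rewrite !inE eq_sym vw eq_sym uw.
have inSw : u \in S :\ w by rewrite !inE uw.
have Lu : (m.+1 <= ord (S :\ u))%N by have := ord_del_leS inSu; rewrite Euv addn2.
have Lv : (m.+1 <= ord (S :\ v))%N by have := ord_del_leS inSv; rewrite Evw addn2.
have Lw : (m.+1 <= ord (S :\ w))%N.
  by have := ord_del_leS inSw; rewrite setD1C Euw addn2.
have step k : (k < 2)%N -> (m + k.+1 <= ord (S :\ u :\ v :\ w))%N ->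
    (m + k.+2 <= ord (S :\ u :\ v :\ w))%N.
  move=> k2; rewrite ord_geq => duvw.
  have := ord_dvd (S :\ u :\ v); rewrite Euv => duv.
  have := ord_dvd (S :\ u :\ w); rewrite Euw => duw.
  have := ord_dvd (S :\ v :\ w); rewrite Evw => dvw.
  have dS : d m (P S) := ord_dvd S; move: Lu Lv Lw; rewrite !ord_geq => du dv dw.
  have dC : d (2 * m + k.+2) (P (S :\ u :\ w) * P (S :\ v :\ w)
      - P (S :\ w) * P (S :\ u :\ v :\ w)).
    by apply: dvdp_sub; [apply: dvdp_XsubC_mul duw dvw | apply: dvdp_XsubC_mul dw duvw];
      clearbody m; clear -k2; lia.
  have dA : d (2 * m + 2) (P (S :\ u) * P (S :\ v) - P S * P (S :\ u :\ v)).
    by apply: dvdp_sub; [apply: dvdp_XsubC_mul du dv | apply: dvdp_XsubC_mul dS duv];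
      clearbody m; clear -k2; lia.
  (* This amounts to k <= 1, so exactly two improvements are available. *)
  have le_n : ((2 * (2 * m + k.+1)).+1 <= 2 * m + k.+2 + (2 * m + 2))%N by clearbody m; clear -k2; lia.
  have dCA := dvdp_XsubC_mul le_n dC dA.
  have := dvdp_sqr_le (fun x => rayleigh_discr x uS vS wS uv uw vw).
  move=> /(_ t (2 * m + k.+1)%N).
  rewrite -mul_polyC => /(_ (dvdp_mull _ dCA)) dB.
  (* The other three products in the middle coefficient have order at least 2m + 3, so its
     divisibility passes to this one. *)
  have : d (2 * m + k.+1).+1 (P S * P (S :\ u :\ v :\ w)).
    rewrite -[X in _ %| X](subKr (P (S :\ u) * P (S :\ v :\ w)
      + P (S :\ u :\ w) * P (S :\ v) - P (S :\ w) * P (S :\ u :\ v))).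
    apply: dvdp_sub _ dB; apply: dvdp_sub.
      by apply: dvdp_add; [apply: dvdp_XsubC_mul du dvw | apply: dvdp_XsubC_mul duw dv];
      clearbody m; clear -k2; lia.
    by apply: dvdp_XsubC_mul dw duv;
      clearbody m; clear -k2; lia.
  rewrite -mup_geq ?mulf_neq0 ?match_poly_neq0 // mupM ?match_poly_neq0 //.
  by rewrite -ord_geq -/m; move: (ord (S :\ u :\ v :\ w)) => n; clearbody m; clear; lia.
apply/eqP; rewrite eqn_leq; apply/andP; split.
  by have := ord_del_leS inSuv; rewrite Euv addn2 addn3.
apply: (step 1%N) => //; apply: (step 0%N) => //.
by have := ord_leS_del inSuv; rewrite Euv addn2 addn1.
Qed.

(** * Deleting whole sets of vertices *)

Lemma ord_setD_le S X : X \subset S -> (ord (S :\: X) <= ord S + #|X|)%N.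
Proof.
have [n] := ubnP #|X|; elim: n S X => // n IH S X ltXn XS.
have [->|[u uX]] := set_0Vmem X; first by rewrite setD0 cards0 addn0.
move: ltXn; rewrite (cardsD1 u) uX => ltXn.
have uS := subsetP XS u uX.
have -> : S :\: X = (S :\ u) :\: (X :\ u) by rewrite setDDl setD1K.
have := IH (S :\ u) (X :\ u) ltXn (setSD _ XS).
by have := ord_del_leS uS; lia.
Qed.

(** After w is deleted, pairs containing w supply the hypothesis on single vertices, and triples
    containing w the hypothesis on pairs. Stating the former separately covers one-element sets,
    where the latter is void. *)
Lemma ord_setD_nice S X : X \subset S ->
  (forall u, u \in X -> ord (S :\ u) = (ord S).+1) ->
  (forall u v, u \in X -> v \in X -> u != v -> ord (S :\ u :\ v) = (ord S + 2)%N) ->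
  ord (S :\: X) = (ord S + #|X|)%N.
Proof.
have [n] := ubnP #|X|; elim: n S X => // n IH S X ltXn XS h1 h2.
have [->|[w wX]] := set_0Vmem X; first by rewrite setD0 cards0 addn0.
move: ltXn; rewrite (cardsD1 w) wX => ltXn.
have -> : S :\: X = (S :\ w) :\: (X :\ w) by rewrite setDDl setD1K.
rewrite (IH (S :\ w) (X :\ w) ltXn (setSD _ XS)) ?h1 // ?addSnnS //.
  by move=> u; rewrite !inE => /andP [uw uX]; rewrite h2 ?addn2 // eq_sym.
move=> u v; rewrite !inE => /andP [uw uX] /andP [vw vX] uv.
rewrite (ord_triple (u := w)) ?(subsetP XS) ?h2 // 1?eq_sym //; lia.
Qed.

End Multiplicity.

(* theta ranges over an arbitrary real closed field R (e.g. the reals). *)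
Theorem theorem3p15 (R : rcfType) (T : finType) (e : rel T)
  (e_sym : symmetric e) (e_irr : irreflexive e)
  (theta : R) (X : {set T}) (hX : (1 < #|X|)%N) :
  extreme e theta X <-> nice e theta X.
Proof.
rewrite /extreme /nice /mult /del setC0 -setTD.
have pairE (u v : T) : ~: [set u; v] = setT :\ u :\ v by rewrite -setTD setDDl.
have squeeze (m b c : nat) :
    (b <= m + 2 -> 2 <= c -> m + c <= b + (c - 2) -> b = m + 2)%N by lia.
split=> [ext | [_ pairs]].
  split=> // u v uX vX uv; rewrite -setTD.
  have YX : [set u; v] \subset X by rewrite subUset !sub1set uX.
  have up := ord_setD_le e_sym e_irr theta (subsetT [set u; v]).
  (* The other #|X| - 2 vertices raise the order by at most #|X| - 2, so u and v must already
     account for 2. *)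
  have := ord_setD_le e_sym e_irr theta (setSD [set u; v] (subsetT X)).
  rewrite setDDl -{1}(setIidPr YX) setID ext cardsDS //.
  by have := subset_leq_card YX; move: up; rewrite cards2 uv; apply: squeeze.
apply: (ord_setD_nice e_sym e_irr) => // [u uX|u v uX vX uv]; last by rewrite -pairE pairs.
(* A partner v exists as #|X| > 1. Deleting u and v gains 2 in two steps of at most 1, so deleting u
   gains exactly 1. *)
have [v] : exists v, v \in X :\ u.
  by apply/card_gt0P; move: hX; rewrite (cardsD1 u) uX.
rewrite !inE => /andP [vu vX].
have vTu : v \in [set: T] :\ u by rewrite !inE vu.
have := ord_del_leS e_sym e_irr theta vTu.
have := ord_del_leS e_sym e_irr theta (in_setT u).
rewrite -pairE pairs // 1?eq_sym // addn2 ltnS => le1 le2.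
by apply/eqP; rewrite eqn_leq le1 le2.
Qed.
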